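(* Let $f\in\mathcal{F}_{c_1}^A(\mathbb{R}^n)$ with $c_1>0$ and let $g\in\mathcal{F}_{0}(\mathbb{R}^m)$ be $L$-smooth. Assume that $N\geq 5$ and $B$ has full row rank, and let $(x^k,z^k,\lambda^k)_{k=1}^N$ be generated by ADMM with step length $t>0$ from $\lambda^0,z^0$. If $t<\min\left\{\tfrac{c_1}{2}, \tfrac{L}{2\lambda_{\min}(BB^T)} \right\}$, then $$D(\lambda^\star)-D(\lambda^N)\leq \rho\left(\tfrac{L}{L+t\lambda_{\min}(BB^T)} \right)^{2N},$$ where $\rho=\tfrac{V^0}{16t}\left(\tfrac{L}{L+t\lambda_{\min}(BB^T)} \right)^{-10}$ and $V^0=\|\lambda^0-\lambda^\star\|^2+t^2\|z^0-z^\star\|_B^2$.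
   Context: Problem: $\min_{(x,z)\in\mathbb{R}^n\times\mathbb{R}^m} f(x)+g(z)$ subject to $Ax+Bz=b$, where $f:\mathbb{R}^n\to\mathbb{R}\cup\{\infty\}$ and $g:\mathbb{R}^m\to\mathbb{R}\cup\{\infty\}$ are closed proper convex functions, $0\neq A\in\mathbb{R}^{r\times n}$, $0\neq B\in\mathbb{R}^{r\times m}$, $b\in\mathbb{R}^r$. The dual objective is $D(\lambda)=\min_{(x,z)} f(x)+g(z)+\langle\lambda,Ax+Bz-b\rangle$ (value $-\infty$ if unbounded below). Standing assumptions: $(x^\star,z^\star)$ is an optimal solution of the problem with corresponding Lagrange multiplier $\lambda^\star$ (a maximizer of $D$); strong duality holds, i.e. $\max_{\lambda} D(\lambda)=\min_{Ax+Bz=b} f(x)+g(z)$; each subproblem of ADMM attains its minimum. ADMM with step length $t>0$ and starting points $\lambda^0,z^0$: for $k=1,\dots,N$, 1. $x^{k}\in\operatorname{argmin}_x f(x)+\langle\lambda^{k-1},Ax\rangle+\tfrac{t}{2}\|Ax+Bz^{k-1}-b\|^2$; 2. $z^{k}\in\operatorname{argmin}_z g(z)+\langle\lambda^{k-1},Bz\rangle+\tfrac{t}{2}\|Ax^k+Bz-b\|^2$; 3. $\lambda^k=\lambda^{k-1}+t(Ax^k+Bz^k-b)$. Notation: $\|x\|_A=\|Ax\|$, $\|z\|_B=\|Bz\|$ with $\|\cdot\|$ Euclidean; $\lambda_{\min}(M)$ is the smallest eigenvalue of a symmetric matrix $M$. $\mathcal{F}_0(\mathbb{R}^m)$ is the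 set of closed proper convex functions on $\mathbb{R}^m$. $\mathcal{F}^A_{c}(\mathbb{R}^n)$ is the set of closed proper functions $f$ on $\mathbb{R}^n$ that are $c$-strongly convex relative to $\|\cdot\|_A$, i.e. $f-\tfrac{c}{2}\|\cdot\|_A^2$ is convex. A differentiable function $g$ is $L$-smooth if $\|\nabla g(z_1)-\nabla g(z_2)\|\leq L\|z_1-z_2\|$ for all $z_1,z_2$. *)

(* Defs.v *)
From HB Require Import structures.
From mathcomp Require Import all_boot all_order all_algebra.
From mathcomp Require Import all_classical all_reals all_analysis.

Set Implicit Arguments.
Unset Strict Implicit.
Unset Printing Implicit Defensive.

Import Order.TTheory GRing.Theory Num.Theory.
Import numFieldNormedType.Exports.

Local Open Scope classical_set_scope.
Local Open Scope ring_scope.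

Section Euclidean.
Context {R : realType}.

Definition dotp (n : nat) (u v : 'cV[R]_n) : R := \sum_i u i 0 * v i 0.

(* The norm `|u| that the library puts on matrices is the sup norm, hence a
   separate Euclidean norm. Both induce the same topology and the same
   (Frechet) differential, so closed, differentiable and 'd can be used as is. *)
Definition enorm (n : nat) (u : 'cV[R]_n) : R := Num.sqrt (dotp u u).

Definition seminorm_mx (r n : nat) (A : 'M[R]_(r, n)) (x : 'cV[R]_n) : R :=
  enorm (A *m x).

(* By convention 0 if M has no (real) eigenvalue, which does not happen for a
   symmetric matrix of positive size. *)
Definition lambda_min (n : nat) (M : 'M[R]_n) : R :=
  xget 0 [set a | eigenvalue M a /\ forall b, eigenvalue M b -> a <= b].

Definition gradient (n : nat) (h : 'cV[R]_n -> R) (x : 'cV[R]_n) : 'cV[R]_n :=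
  \col_i 'd h x (delta_mx i 0).

End Euclidean.

Section ConvexFunctions.
Context {R : realType}.
Local Open Scope ereal_scope.

(* A function R^n -> R \cup {oo} is a function to \bar R avoiding -oo; this
   requirement is part of proper_fun. In \bar R, 0 * +oo = 0. *)
Definition proper_fun (n : nat) (f : 'cV[R]_n -> \bar R) : Prop :=
  (forall x, f x != -oo) /\ (exists x, f x < +oo).

Definition convex_fun (n : nat) (f : 'cV[R]_n -> \bar R) : Prop :=
  forall (x y : 'cV[R]_n) (s : R), (0 <= s <= 1)%R ->
    f (s *: x + (1 - s) *: y)%R <= s%:E * f x + (1 - s)%:E * f y.

Definition closed_fun (n : nat) (f : 'cV[R]_n -> \bar R) : Prop :=
  closed [set p : 'cV[R]_n * R | f p.1 <= (p.2)%:E].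

Definition F0 (n : nat) : set ('cV[R]_n -> \bar R) :=
  [set f | [/\ closed_fun f, proper_fun f & convex_fun f]].

Definition Fc (r n : nat) (A : 'M[R]_(r, n)) (c : R) :
    set ('cV[R]_n -> \bar R) :=
  [set f | [/\ closed_fun f, proper_fun f &
    convex_fun (fun x => f x - (c / 2 * seminorm_mx A x ^+ 2)%:E)]].

(* A differentiable function is in particular finite everywhere. *)
Definition L_smooth (n : nat) (L : R) (g : 'cV[R]_n -> \bar R) : Prop :=
  let h := fine \o g in
  [/\ forall z, g z \is a fin_num,
      forall z, differentiable h z &
      forall z1 z2,
        (enorm (gradient h z1 - gradient h z2) <= L * enorm (z1 - z2))%R].

Definition argmin (T : Type) (F : T -> \bar R) : set T :=
  [set u | forall v, F u <= F v].

Definition argmax (T : Type) (F : T -> \bar R) : set T :=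
  [set u | forall v, F v <= F u].

End ConvexFunctions.

Section Problem.
Context {R : realType} {n m r : nat}.
Variables (f : 'cV[R]_n -> \bar R) (g : 'cV[R]_m -> \bar R).
Variables (A : 'M[R]_(r, n)) (B : 'M[R]_(r, m)) (b : 'cV[R]_r).
Local Open Scope ereal_scope.

Definition feasible (x : 'cV[R]_n) (z : 'cV[R]_m) : Prop :=
  (A *m x + B *m z = b)%R.

Definition optimal_solution (x : 'cV[R]_n) (z : 'cV[R]_m) : Prop :=
  feasible x z /\ forall x' z', feasible x' z' -> f x + g z <= f x' + g z'.

Definition dual (l : 'cV[R]_r) : \bar R :=
  ereal_inf (range (fun p : 'cV[R]_n * 'cV[R]_m =>
    f p.1 + g p.2 + (dotp l (A *m p.1 + B *m p.2 - b)%R)%:E)).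

(* x 0 plays no role: the starting data are z 0 and l 0. *)
Definition admm (t : R) (N : nat) (x : nat -> 'cV[R]_n) (z : nat -> 'cV[R]_m)
    (l : nat -> 'cV[R]_r) : Prop :=
  forall k, (k < N)%N ->
  [/\ argmin (fun u => f u + (dotp (l k) (A *m u)
        + t / 2 * enorm (A *m u + B *m z k - b) ^+ 2)%:E) (x k.+1),
      argmin (fun w => g w + (dotp (l k) (B *m w)
        + t / 2 * enorm (A *m x k.+1 + B *m w - b) ^+ 2)%:E) (z k.+1) &
      l k.+1 = (l k + t *: (A *m x k.+1 + B *m z k.+1 - b))%R].

End Problem.

(* Main.v *)
Require Import Defs.
From mathcomp Require Import all_boot all_order all_algebra.
From mathcomp Require Import all_classical all_reals all_analysis.
From mathcomp Require Import ring lra.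

(* In the scaled variables p = (l - ls) / t, y = B (z - zs), a = A (x - xs) the
   optimality conditions of the subproblems say that
     nu_k = p_k + y_{k-1} - y_k  and  p_k
   are, up to sign, subgradients at a_k and y_k of two convex functions F and G
   vanishing at their common minimizer 0, where F is strongly convex and G is
   strongly convex in p (smoothness of g and full row rank of B), with modulus
   th = t * lambda_min (B B^T) / L.
   With V_k = |p_k|^2 + |y_k|^2, three consequences are combined:
   V_1 <= V_0, with no contraction since nothing relates l_0 to z_0;
   V_{k+1} <= V_k / (1 + th)^2 for k >= 1, where 1 / (1 + th) = q;
   the dual gap is at most t * V / 16 after four more steps.
   The last two are weighted sums of the inequalities between the iterates and
   the solution, with weights obtained from the dual of the performance
   estimation semidefinite program. *)

Set Implicit Arguments.
Unset Strict Implicit.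
Unset Printing Implicit Defensive.

Import Order.TTheory GRing.Theory Num.Theory.
Import numFieldNormedType.Exports.
Local Open Scope classical_set_scope.
Local Open Scope ring_scope.

(** * Euclidean inner product *)

Section InnerProduct.
Context {R : realType}.

Lemma dotpC n (u v : 'cV[R]_n) : dotp u v = dotp v u.
Proof. by apply: eq_bigr => i _; rewrite mulrC. Qed.

Lemma dotpDl n (u v w : 'cV[R]_n) : dotp (u + v) w = dotp u w + dotp v w.
Proof. by rewrite /dotp -big_split; apply: eq_bigr => i _; rewrite mxE mulrDl. Qed.

Lemma dotpDr n (u v w : 'cV[R]_n) : dotp u (v + w) = dotp u v + dotp u w.
Proof. by rewrite dotpC dotpDl !(dotpC _ u). Qed.

Lemma dotpZl n (s : R) (u v : 'cV[R]_n) : dotp (s *: u) v = s * dotp u v.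
Proof. by rewrite /dotp mulr_sumr; apply: eq_bigr => i _; rewrite mxE mulrA. Qed.

Lemma dotpZr n (s : R) (u v : 'cV[R]_n) : dotp u (s *: v) = s * dotp u v.
Proof. by rewrite dotpC dotpZl dotpC. Qed.

Lemma dotpNl n (u v : 'cV[R]_n) : dotp (- u) v = - dotp u v.
Proof. by rewrite -scaleN1r dotpZl mulN1r. Qed.

Lemma dotpNr n (u v : 'cV[R]_n) : dotp u (- v) = - dotp u v.
Proof. by rewrite dotpC dotpNl dotpC. Qed.

Lemma dotp0l n (v : 'cV[R]_n) : dotp 0 v = 0.
Proof. by rewrite -(scale0r 0) dotpZl mul0r. Qed.

Lemma dotp0r n (v : 'cV[R]_n) : dotp v 0 = 0.
Proof. by rewrite dotpC dotp0l. Qed.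

Definition dotpE := (dotpDl, dotpDr, dotpNl, dotpNr, dotpZl, dotpZr).

Lemma dotp_ge0 n (u : 'cV[R]_n) : 0 <= dotp u u.
Proof. by apply: sumr_ge0 => i _; rewrite -expr2 sqr_ge0. Qed.

Lemma dotp_eq0 n (u : 'cV[R]_n) : (dotp u u == 0) = (u == 0).
Proof.
apply/eqP/eqP => [|->]; last exact: dotp0l.
move=> /eqP; rewrite psumr_eq0 => [/allP u0|i _]; last by rewrite -expr2 sqr_ge0.
apply/colP => i; rewrite mxE; apply/eqP.
by have := u0 i; rewrite mem_index_enum /= mulf_eq0 orbb; apply.
Qed.

Lemma dotp_mulmx m n (M : 'M[R]_(m, n)) (u : 'cV[R]_m) (v : 'cV[R]_n) :
  dotp u (M *m v) = dotp (M^T *m u) v.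
Proof.
rewrite /dotp; under eq_bigr => i _ do rewrite mxE mulr_sumr.
rewrite exchange_big; apply: eq_bigr => j _; rewrite mxE mulr_suml.
by apply: eq_bigr => i _; rewrite mxE mulrCA mulrA.
Qed.

Lemma enorm_sqr n (u : 'cV[R]_n) : enorm u ^+ 2 = dotp u u.
Proof. by rewrite sqr_sqrtr ?dotp_ge0. Qed.

(** Cauchy-Schwarz, by expanding the squared norm of [dotp v v *: u - dotp u v *: v], a multiple of
    the component of [u] orthogonal to [v]. *)
Lemma dotp_le_enorm n (u v : 'cV[R]_n) : dotp u v <= enorm u * enorm v.
Proof.
have [v0|v_neq0] := eqVneq v 0.
  by rewrite v0 dotp0r mulr_ge0 // sqrtr_ge0.
have vv_gt0 : 0 < dotp v v by rewrite lt_def dotp_eq0 v_neq0 dotp_ge0.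
have CS : dotp u v ^+ 2 <= dotp u u * dotp v v.
  have := dotp_ge0 (dotp v v *: u - dotp u v *: v).
  rewrite !dotpE (dotpC v u) => h.
  have {h} : 0 <= dotp v v * (dotp u u * dotp v v - dotp u v ^+ 2).
    by apply: le_trans h _; rewrite le_eqVlt; apply/orP; left; apply/eqP; ring.
  by rewrite pmulr_rge0 // subr_ge0.
rewrite /enorm -sqrtrM ?dotp_ge0 //.
by rewrite (le_trans (ler_norm _)) // -sqrtr_sqr ler_wsqrtr.
Qed.

End InnerProduct.

(** * Inequalities over one step and over four steps, in scaled variables *)

Section Recursion.
Context {R : realType} {n : nat}.
Implicit Types p y a : 'cV[R]_n.

(** Merging all sums into one reduces a relation between inner products to a polynomial relation in
    each coordinate. *)
Let collect_add (F G : 'I_n -> R) : \sum_i F i + \sum_i G i = \sum_i (F i + G i).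
Proof. by rewrite big_split. Qed.

Let collect_opp (F : 'I_n -> R) : - (\sum_i F i) = \sum_i (- F i).
Proof. by rewrite sumrN. Qed.

Let collect_mul (c : R) (F : 'I_n -> R) : c * (\sum_i F i) = \sum_i (c * F i).
Proof. by rewrite mulr_sumr. Qed.

Let collect := (collect_add, collect_opp, collect_mul).

(** The hypotheses are strong monotonicity of the subgradients of F and of G between an iterate and
    the solution, and of G between consecutive iterates. *)
Lemma admm_step_contraction (th : R) p y p' y' (a := p' - p - y') :
  0 <= th -> th < 2^-1 ->
  2 * dotp a a <= - dotp (p' + y - y') a ->
  th * dotp p' p' <= - dotp p' y' ->
  th * dotp (p' - p) (p' - p) <= - dotp (p' - p) (y' - y) ->
  (1 + th) ^+ 2 * (dotp p' p' + dotp y' y') <= dotp p p + dotp y y.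
Proof.
move=> th0 th2; have {}th2 : 2 * th < 1 by lra.
rewrite -subr_ge0 => fa; rewrite -subr_ge0 => gs; rewrite -subr_ge0 => gp.
have d0 : 0 < 1 - th by lra.
(* The difference of the two sides is u^2 + v^2 + k a^2 plus the hypotheses with
   weights phi, 2 (1 + th), 2 (1 + th). *)
pose phi := 2 * (1 + th ^+ 2) / (1 - th).
pose k := 1 + 2 * th * (1 + th) + 2 * phi
   - ((1 + th) / (1 - th)) ^+ 2 - (2 * th ^+ 2 / (1 - th)) ^+ 2.
have phi0 : 0 <= phi.
  by apply: divr_ge0; [rewrite mulr_ge0 ?addr_ge0 ?sqr_ge0 | exact: ltW].
have k0 : 0 <= k.
  have -> : k = (4 - 6 * th + 2 * th ^+ 2 - 6 * th ^+ 3 - 2 * th ^+ 4) / (1 - th) ^+ 2.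
    by rewrite /k /phi; field; lra.
  apply: divr_ge0; last exact: sqr_ge0.
  have th2_le : 4 * th ^+ 2 <= 1.
    have -> : 4 * th ^+ 2 = (2 * th) ^+ 2 by ring.
    by rewrite exprn_ile1 ?(ltW th2) // mulr_ge0.
  have : 4 * th ^+ 3 <= th by rewrite exprS mulrCA ler_piMr.
  have : 4 * th ^+ 4 <= th ^+ 2 by rewrite (exprD _ 2 2) mulrA ler_piMl ?sqr_ge0.
  nra.
pose u := y' + th *: p' + ((1 + th) / (1 - th)) *: a.
pose v := y - (1 + th) *: y' + (2 * th ^+ 2 / (1 - th)) *: a.
rewrite -subr_ge0.
have -> : dotp p p + dotp y y - (1 + th) ^+ 2 * (dotp p' p' + dotp y' y') =
  dotp u u + dotp v v + k * dotp a a
  + phi * (- dotp (p' + y - y') a - 2 * dotp a a)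
  + 2 * (1 + th) * (- dotp p' y' - th * dotp p' p')
  + 2 * (1 + th) * (- dotp (p' - p) (y' - y) - th * dotp (p' - p) (p' - p)).
  rewrite /dotp !collect; apply: eq_bigr => i _.
  by rewrite /u /v /a !mxE /k /phi; field; lra.
have th1 : 0 <= 2 * (1 + th) by lra.
have := mulr_ge0 th1 gp; have := mulr_ge0 th1 gs; have := mulr_ge0 phi0 fa.
have := mulr_ge0 k0 (dotp_ge0 a); have := dotp_ge0 u; have := dotp_ge0 v.
lra.
Qed.

(** Only monotonicity between the new iterate and the solution enters, so this covers the first
    step, whose starting data are arbitrary. *)
Lemma admm_step_nonexpansive p y p' y' (a := p' - p - y') :
  0 <= - dotp (p' + y - y') a -> 0 <= - dotp p' y' ->
  dotp p' p' + dotp y' y' <= dotp p p + dotp y y.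
Proof.
move=> fa gs; rewrite -subr_ge0; pose u := p' - p - y' + y.
have -> : dotp p p + dotp y y - (dotp p' p' + dotp y' y') =
  dotp u u + 2 * - dotp (p' + y - y') a + 2 * - dotp p' y'.
  by rewrite /dotp !collect; apply: eq_bigr => i _; rewrite /u /a !mxE; ring.
by rewrite !addr_ge0 ?mulr_ge0 ?dotp_ge0.
Qed.

(** The term with factor 1/4 is what Young's inequality leaves in the final estimate of the dual
    gap. Besides comparisons with the solution and from each iterate to the next, one backward
    comparison is needed, [g01]. *)
Lemma dual_gap_four_steps (p y : nat -> 'cV[R]_n) (F G : nat -> R)
    (a := fun k => p k.+1 - p k - y k.+1)
    (nu := fun k => p k.+1 + y k - y k.+1) :
  (forall k, (k < 4)%N -> dotp (a k) (a k) <= F k.+1) ->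
  (forall k, (k < 3)%N -> F k.+1 - dotp (nu k) (a k.+1 - a k)
     + dotp (a k.+1 - a k) (a k.+1 - a k) <= F k.+2) ->
  (forall k, (k < 4)%N -> 0 <= G k.+1) ->
  (forall k, (k < 4)%N -> G k - dotp (p k) (y k.+1 - y k) <= G k.+1) ->
  G 1%N - dotp (p 1%N) (y 0%N - y 1%N) <= G 0%N ->
  - F 4 - G 4 - dotp (p 4) (a 3 + y 4) + 4^-1 * dotp (y 4 - y 3) (y 4 - y 3)
  <= 16^-1 * (dotp (p 0%N) (p 0%N) + dotp (y 0%N) (y 0%N)).
Proof.
move=> f0 f1 g0 g1 g01.
(* One coordinate of the weighted sum. For F, the weights of the consecutive comparisons, 1/7, 5/14
   and 5/8, are the partial sums of the weights 1/7, 3/14, 15/56 and 3/8 against the solution, so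
   that all values but the last cancel. *)
have sos (p0 p1 p2 p3 p4 y0 y1 y2 y3 y4 : R) :
    let a1 := p1 - p0 - y1 in let a2 := p2 - p1 - y2 in
    let a3 := p3 - p2 - y3 in let a4 := p4 - p3 - y4 in
    0 <= 16^-1 * (p0 * p0 + y0 * y0) + p4 * (a4 + y4)
      + - (4^-1 * ((y4 - y3) * (y4 - y3)))
      + 7^-1 * (a1 * a1) + 3 / 14 * (a2 * a2) + 15 / 56 * (a3 * a3) + 3 / 8 * (a4 * a4)
      + 7^-1 * ((a2 - a1) * (a2 - a1) + - ((p1 + y0 - y1) * (a2 - a1)))
      + 5 / 14 * ((a3 - a2) * (a3 - a2) + - ((p2 + y1 - y2) * (a3 - a2)))
      + 5 / 8 * ((a4 - a3) * (a4 - a3) + - ((p3 + y2 - y3) * (a4 - a3)))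
      + - (7^-1 * (p0 * (y1 - y0))) + - (7^-1 * (p1 * (y0 - y1)))
      + - (6^-1 * (p1 * (y2 - y1))) + - (5 / 14 * (p2 * (y3 - y2)))
      + - (5 / 8 * (p3 * (y4 - y3))).
  move=> a1 a2 a3 a4; rewrite /a1 /a2 /a3 /a4.
  (* The first six squares complete the square in p0, p4, y4, y0, p3, y3; what
     remains is a form in p1, y2, p2, y1 in the cone of the other ten. *)
  have := sqr_ge0 (39 * p0 - 56 * p1 - 16 * y2 + 16 * p2 + 32 * y1).
  have := sqr_ge0 (32 * p4 - 16 * y4 - 39 * p3 + 15 * y3 - 5 * y2 + 10 * p2).
  have := sqr_ge0 (8 * y4 + 13 * p3 - 7 * y3 + 5 * y2 - 10 * p2).
  have := sqr_ge0 (7 * y0 + 8 * p1 + 8 * y2 - 8 * p2 - 8 * y1).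
  have := sqr_ge0 (4011 * p3 - 3591 * y3 + 1280 * p1 + 1885 * y2 - 5210 * p2 - 640 * y1).
  have := sqr_ge0 (8309 * y3 - 3200 * p1 - 8055 * y2 + 4430 * p2 + 1600 * y1).
  have := sqr_ge0 (15 * p1 + 12 * y2 - 17 * p2 - 3 * y1).
  have := sqr_ge0 (15 * p1 + 12 * y2 - 16 * p2 - 3 * y1).
  have := sqr_ge0 (15 * p1 + 13 * y2 - 16 * p2 - 3 * y1).
  have := sqr_ge0 (15 * p1 + 13 * y2 - 16 * p2 - 2 * y1).
  have := sqr_ge0 (3 * y2 - p2 - y1).
  have := sqr_ge0 (3 * y2 - y1).
  have := sqr_ge0 y2.
  have := sqr_ge0 (p2 + 4 * y1).
  have := sqr_ge0 (p2 + 5 * y1).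
  have := sqr_ge0 y1.
  lra.
have : 0 <= 16^-1 * (dotp (p 0%N) (p 0%N) + dotp (y 0%N) (y 0%N))
   + dotp (p 4) (a 3 + y 4) + - (4^-1 * dotp (y 4 - y 3) (y 4 - y 3))
   + 7^-1 * dotp (a 0%N) (a 0%N) + 3 / 14 * dotp (a 1%N) (a 1%N)
   + 15 / 56 * dotp (a 2) (a 2) + 3 / 8 * dotp (a 3) (a 3)
   + 7^-1 * (dotp (a 1%N - a 0%N) (a 1%N - a 0%N) + - dotp (nu 0%N) (a 1%N - a 0%N))
   + 5 / 14 * (dotp (a 2 - a 1%N) (a 2 - a 1%N) + - dotp (nu 1%N) (a 2 - a 1%N))
   + 5 / 8 * (dotp (a 3 - a 2) (a 3 - a 2) + - dotp (nu 2) (a 3 - a 2))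
   + - (7^-1 * dotp (p 0%N) (y 1%N - y 0%N)) + - (7^-1 * dotp (p 1%N) (y 0%N - y 1%N))
   + - (6^-1 * dotp (p 1%N) (y 2 - y 1%N)) + - (5 / 14 * dotp (p 2) (y 3 - y 2))
   + - (5 / 8 * dotp (p 3) (y 4 - y 3)).
  rewrite /dotp !collect; apply: sumr_ge0 => i _; rewrite /a /nu !mxE.
  exact: (sos (p 0%N i 0) (p 1%N i 0) (p 2 i 0) (p 3 i 0) (p 4 i 0)
    (y 0%N i 0) (y 1%N i 0) (y 2 i 0) (y 3 i 0) (y 4 i 0)).
have := f0 0%N isT; have := f0 1%N isT; have := f0 2 isT; have := f0 3 isT.
have := f1 0%N isT; have := f1 1%N isT; have := f1 2 isT.
have := g0 0%N isT; have := g0 1%N isT; have := g0 2 isT; have := g0 3 isT.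
have := g1 0%N isT; have := g1 1%N isT; have := g1 2 isT; have := g1 3 isT.
lra.
Qed.

End Recursion.

(** * First-order calculus of smooth convex functions *)

Section SmoothConvex.
Context {R : realType} {n : nat}.
Implicit Types (h : 'cV[R]_n -> R) (u v w d : 'cV[R]_n) (L : R).

(** Dividing by [s] and letting it tend to 0, without a limit: for negative [a] an explicit [s] in
    (0, 1] with [s * C < - a] gives a contradiction. All first-order optimality conditions below
    rest on this. *)
Lemma ge0_of_first_order (a C : R) :
  (forall s, 0 < s <= 1 -> 0 <= s * a + s ^+ 2 * C) -> 0 <= a.
Proof.
move=> H; rewrite leNgt; apply/negP => a0.
have k0 : 0 < `|C| + 1 - a by rewrite subr_gt0 (lt_trans a0) // ltr_wpDl.
pose s := - a / (`|C| + 1 - a).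
have s0 : 0 < s by rewrite divr_gt0 // oppr_gt0.
have s1 : s <= 1 by rewrite ler_pdivrMr // mul1r lerBrDr addNr addr_ge0.
have := H s; rewrite s0 s1 => /(_ isT).
have -> : s * a + s ^+ 2 * C = s * (a + s * C) by ring.
rewrite pmulr_rge0 // leNgt => /negP; apply.
have : s * C <= s * `|C| by rewrite ler_wpM2l ?ler_norm // ltW.
have : s * `|C| < s * (`|C| + 1 - a) by rewrite ltr_pM2l //; lra.
rewrite {2}/s divfK ?gt_eqF //; lra.
Qed.

Lemma diff_gradient h u d : differentiable h u -> 'd h u d = dotp (gradient h u) d.
Proof.
move=> hu; have {1}-> : d = \sum_i d i 0 *: delta_mx i 0.
  by rewrite {1}[d]matrix_sum_delta; apply: eq_bigr => i _; rewrite big_ord1.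
by rewrite linear_sum; apply: eq_bigr => i _; rewrite linearZ mxE mulrC.
Qed.

Lemma is_derive_line h u d (s : R) : differentiable h (u + s *: d) ->
  is_derive s (1 : R) (fun s : R => h (u + s *: d)) (dotp (gradient h (u + s *: d)) d).
Proof.
move=> hd; rewrite -diff_gradient // -deriveE //.
(* The difference quotients along the line are those of the directional derivative, which replaces
   the chain rule. *)
have E : (fun k : R => k^-1 *: (((fun s => h (u + s *: d)) \o shift s) (k *: 1)
    - h (u + s *: d))) =
    (fun k : R => k^-1 *: ((h \o shift (u + s *: d)) (k *: d) - h (u + s *: d))).
  apply/funext => k /=; congr (_ *: (h _ - _)).
  by rewrite [k *: _]mulr1 scalerDl addrCA.
split; first by rewrite /derivable E; exact: diff_derivable.
by rewrite /derive E.
Qed.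

(** Along the segment, subtract from [h] the linear and quadratic terms of the bound: the difference
    [psi] has nonpositive derivative by Cauchy-Schwarz and the Lipschitz condition, and the mean
    value theorem gives [psi 1 <= psi 0]. *)
Lemma descent_lemma h L u v : (forall z, differentiable h z) ->
  (forall z1 z2, enorm (gradient h z1 - gradient h z2) <= L * enorm (z1 - z2)) ->
  h v <= h u + dotp (gradient h u) (v - u) + L / 2 * dotp (v - u) (v - u).
Proof.
move=> hd hL; have {hd} := fun d s => is_derive_line (hd (u + s *: d)).
(* Hiding the definition of the gradient keeps unification from unfolding it. *)
move: (gradient h) hL => gr hL gr_line.
set d := v - u; have -> : v = u + 1 *: d by rewrite scale1r addrC subrK.
pose c := dotp (gr u) d; pose D := dotp d d.
pose psi := fun s : R => h (u + s *: d) - (s * c + s ^+ 2 * (L / 2 * D)).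
pose dpsi := fun s : R => dotp (gr (u + s *: d)) d - (c + s * (L * D)).
have psi_der (s : R) : is_derive s (1 : R) psi (dpsi s).
  apply: is_deriveB.
  apply: is_derive_eq.
  change (s * 0 + c * 1 + (s ^+ 2 * 0 + (L / 2 * D) * (s * 1 + s * 1)) = c + s * (L * D)).
  by field.
have psi_cont : {within `[(0 : R), 1], continuous psi}.
  by apply: derivable_within_continuous => s _; case: (psi_der s).
have [s] := MVT ltr01 (fun r _ => psi_der r) psi_cont.
rewrite in_itv /= => /andP[s0 _]; rewrite subr0 mulr1 /psi /dpsi => E.
have : dotp (gr (u + s *: d) - gr u) d <= s * (L * D).
  apply: le_trans (dotp_le_enorm _ _) _.
  apply: le_trans (ler_wpM2r (sqrtr_ge0 _) (hL _ _)) _.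
  rewrite addrC addKr; have -> : enorm (s *: d) = s * enorm d.
    by rewrite /enorm dotpZl dotpZr mulrA -expr2 sqrtrM ?sqr_ge0 // sqrtr_sqr gtr0_norm.
  by rewrite -mulrA -mulrA -expr2 enorm_sqr mulrCA.
rewrite dotpDl dotpNl -/c -/D; move: E; rewrite [in h (u + 0 *: d)]scale0r addr0.
lra.
Qed.

Section ConvexGradient.
Variables (L : R) (h : 'cV[R]_n -> R).
Hypothesis h_diff : forall z, differentiable h z.
Hypothesis h_lip : forall z1 z2,
  enorm (gradient h z1 - gradient h z2) <= L * enorm (z1 - z2).
Hypothesis h_convex : forall x y (s : R), 0 <= s <= 1 ->
  h (s *: x + (1 - s) *: y) <= s * h x + (1 - s) * h y.

(* Convexity turns the upper bound of the descent lemma into a lower bound. *)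
Lemma gradient_inequality u v : h u + dotp (gradient h u) (v - u) <= h v.
Proof.
have := descent_lemma _ _ h_diff h_lip.
move: (gradient h) => gr D; rewrite -subr_ge0.
apply: (@ge0_of_first_order _ (L / 2 * dotp (v - u) (v - u))) => s /andP[s0 s1].
have := @h_convex v u s; rewrite (ltW s0) s1 => /(_ isT).
(* [u] is the midpoint of a point towards [v] and its reflection; the descent lemma bounds [h] at
   the reflection from above. *)
have := @h_convex (u + s *: (v - u)) (u - s *: (v - u)) 2^-1.
rewrite invr_ge0 ler0n invf_le1 ?ltr0n // ler1n => /(_ isT).
have -> : s *: v + (1 - s) *: u = u + s *: (v - u).
  by apply/colP => i; rewrite !mxE; ring.
have -> : 2^-1 *: (u + s *: (v - u)) + (1 - 2^-1) *: (u - s *: (v - u)) = u.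
  by apply/colP => i; rewrite !mxE; field.
have := D u (u - s *: (v - u)).
have -> : u - s *: (v - u) - u = - (s *: (v - u)) by rewrite addrAC subrr add0r.
rewrite !dotpE; lra.
Qed.

Lemma cocoercive_inequality u v : 0 < L ->
  h u + dotp (gradient h u) (v - u)
    + (2 * L)^-1 * dotp (gradient h v - gradient h u) (gradient h v - gradient h u)
  <= h v.
Proof.
move=> L0; have := descent_lemma _ _ h_diff h_lip; have := gradient_inequality.
move: (gradient h) => gr /(_ u) D1 /(_ v) D2; pose w := gr v - gr u; rewrite -/w.
(* This point minimizes the descent bound at [v] minus the tangent at [u]; there the tangent at [u]
   bounds [h] from below and the descent bound from above. *)
have := D1 (v - L^-1 *: w); have := D2 (v - L^-1 *: w).
have -> : v - L^-1 *: w - v = - (L^-1 *: w) by rewrite addrAC subrr add0r.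
have -> : v - L^-1 *: w - u = (v - u) - L^-1 *: w by rewrite addrAC.
have -> : gr v = gr u + w by rewrite /w addrC subrK.
have -> : L / 2 * dotp (- (L^-1 *: w)) (- (L^-1 *: w)) = (2 * L)^-1 * dotp w w.
  by rewrite !dotpE; field; rewrite gt_eqF.
rewrite !dotpE.
have : 2 * ((2 * L)^-1 * dotp w w) = L^-1 * dotp w w by field; rewrite gt_eqF.
lra.
Qed.

Lemma gradient_of_minimizer (l : 'cV[R]_n) (C : 'cV[R]_n -> R) u :
  (forall d (s : R), 0 < s <= 1 -> h u <= h (u + s *: d) + s * dotp l d + s ^+ 2 * C d) ->
  gradient h u = - l.
Proof.
have := descent_lemma _ _ h_diff h_lip.
move: (gradient h) => gr /(_ u) D H; apply/eqP; rewrite -addr_eq0 -dotp_eq0.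
rewrite eq_le dotp_ge0 andbT -oppr_ge0.
(* Testing minimality in the direction of steepest descent forces the square of [gr u + l] to
   vanish. *)
set d := - (gr u + l); have -> : - dotp (gr u + l) (gr u + l) = dotp (gr u + l) d.
  by rewrite dotpNr.
apply: (@ge0_of_first_order _ (L / 2 * dotp d d + C d)) => s s01.
have := H d s s01; have := D (u + s *: d).
rewrite [_ + _ - u]addrAC subrr add0r !dotpE; lra.
Qed.

End ConvexGradient.
End SmoothConvex.

(** * Smallest eigenvalue and Rayleigh quotient *)

Section SmallestEigenvalue.
Context {R : realType} {n : nat}.

Lemma continuous_dotp (T : topologicalType) (F G : T -> 'cV[R]_n) :
  (forall i, continuous (fun x => F x i 0)) -> (forall i, continuous (fun x => G x i 0)) ->
  continuous (fun x => dotp (F x) (G x)).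
Proof.
move=> cF cG; apply: continuous_big; first exact: add_continuous.
by move=> i _ x; apply: continuousM; [exact: cF | exact: cG].
Qed.

(** Weierstrass on the unit sphere, followed by rescaling; [u] makes the sphere nonempty. The
    transposes occur because [EVT_min_rV] concerns row vectors. *)
Lemma rayleigh_min_attained (S : 'M[R]_n) (u : 'cV[R]_n) : u != 0 ->
  exists2 v : 'cV[R]_n, v != 0 & forall w,
    dotp v (S *m v) * dotp w w <= dotp v v * dotp w (S *m w).
Proof.
move=> u0; pose sphere := [set w : 'rV[R]_n | dotp w^T w^T = 1].
have c1 i : continuous (fun w : 'rV[R]_n => w^T i 0).
  by under eq_fun do rewrite mxE; exact: coord_continuous.
have c2 i : continuous (fun w : 'rV[R]_n => (S *m w^T) i 0).
  under eq_fun do rewrite mxE; apply: continuous_big; first exact: add_continuous.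
  by move=> j _ w; apply: continuousM; [exact: cst_continuous | exact: c1].
have unit_sphere (w : 'cV[R]_n) : w != 0 -> ((Num.sqrt (dotp w w))^-1 *: w)^T \in sphere.
  move=> w0; rewrite inE /sphere /= trmxK dotpZl dotpZr mulrA -expr2 exprVn.
  by rewrite sqr_sqrtr ?dotp_ge0 // mulVf // dotp_eq0.
have [|||w ws wmin] := @EVT_min_rV R n (fun w => dotp w^T (S *m w^T)) sphere.
- by exists ((Num.sqrt (dotp u u))^-1 *: u)^T; exact/set_mem/unit_sphere.
- apply: bounded_closed_compact.
    exists 1; split => // M M1 w /= w1; apply: le_trans (ltW M1).
    rewrite [leLHS]mx_normrE; apply: bigmax_le => // -[i j] _ /=.
    rewrite (ord1 i) -(@ler_pXn2r _ 2) ?nnegrE // expr1n real_normK ?num_real // -[leRHS]w1.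
    by rewrite /dotp (bigD1 j) //= !mxE -expr2 lerDl sumr_ge0 // => k _; rewrite -expr2 sqr_ge0.
  apply: (@preimage_closed _ _ (fun w : 'rV[R]_n => dotp w^T w^T) [set 1]).
    by move=> w _; apply: continuous_dotp.
  exact: closed_eq.
- by apply: continuous_subspaceT; apply: continuous_dotp.
exists w^T.
  apply/negP => /eqP w0; move: ws; rewrite inE /sphere /= w0 dotp0l => /esym/eqP.
  by rewrite oner_eq0.
move: ws; rewrite inE /sphere /= => -> x; rewrite mul1r.
have [->|x0] := eqVneq x 0; first by rewrite !dotp0l mulr0.
have xx : 0 < dotp x x by rewrite lt_def dotp_eq0 x0 dotp_ge0.
have := wmin _ (unit_sphere x x0).
rewrite trmxK -scalemxAr dotpZl dotpZr mulrA -expr2 exprVn sqr_sqrtr ?dotp_ge0 //.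
by rewrite ler_pdivlMl // mulrC.
Qed.

(* lambda_min S != 0 excludes the default value of xget. *)
Lemma lambda_minP (S : 'M[R]_n) : S^T = S -> lambda_min S != 0 ->
  eigenvalue S (lambda_min S) /\
  forall u, lambda_min S * dotp u u <= dotp u (S *m u).
Proof.
move=> symS; rewrite /lambda_min; case: xgetP => [l _ [lS lmin] _|_]; last by rewrite eqxx.
split=> // u; have [->|u0] := eqVneq u 0; first by rewrite !dotp0l mulr0.
have [v v0 vmin] := rayleigh_min_attained S u0.
have vv : 0 < dotp v v by rewrite lt_def dotp_eq0 v0 dotp_ge0.
pose a := dotp v (S *m v) / dotp v v.
have amin w : a * dotp w w <= dotp w (S *m w).
  by rewrite /a mulrAC ler_pdivrMr // (mulrC (dotp w _)).
have av : a * dotp v v = dotp v (S *m v) by rewrite divfK ?gt_eqF.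
(* A minimizer of the Rayleigh quotient is an eigenvector: moving [v] against its residual [d]
   changes the quadratic form by [- 2 * dotp d d] to first order. Hence [a] is an eigenvalue, and
   [lambda_min S <= a]. *)
have Sv : S *m v = a *: v.
  apply/eqP; rewrite -subr_eq0 -dotp_eq0 eq_le dotp_ge0 andbT -oppr_ge0.
  set d := S *m v - a *: v.
  have vSd : dotp v (S *m d) = dotp d d + a * dotp v d.
    rewrite dotp_mulmx symS; have -> : S *m v = d + a *: v by rewrite /d subrK.
    by rewrite dotpDl dotpZl.
  have dSv : dotp d (S *m v) = dotp d d + a * dotp v d.
    by rewrite dotp_mulmx symS dotpC vSd.
  move: d vSd dSv => d vSd dSv; suff : 0 <= 2 * - dotp d d by rewrite pmulr_rge0.
  apply: (@ge0_of_first_order _ _ (dotp d (S *m d) - a * dotp d d)) => s _.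
  have := amin (v - s *: d).
  rewrite mulmxBr -scalemxAr !dotpE vSd dSv -av (dotpC d v); lra.
apply: le_trans (amin u); rewrite ler_wpM2r ?dotp_ge0 //; apply: lmin.
apply/eigenvalueP; exists v^T; last by rewrite trmx_eq0.
by rewrite -[in LHS]symS -trmx_mul Sv linearZ.
Qed.

End SmallestEigenvalue.

(** The M + 5 steps split into one nonexpansive step, M contractions and the four steps of the gap
    estimate. The letter [N] is here the index before the last iterate. *)
Lemma dual_gap_decay (R : realType) (n M : nat) (th : R) (p y : nat -> 'cV[R]_n)
    (F G : nat -> R)
    (a := fun k => p k.+1 - p k - y k.+1) (nu := fun k => p k.+1 + y k - y k.+1) (N := M.+4) :
  0 <= th -> th < 2^-1 ->
  (forall k, (k < M.+4.+1)%N -> dotp (a k) (a k) <= F k.+1) ->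
  (forall k, (k < M.+4.+1)%N -> F k.+1 + dotp (nu k) (a k) + dotp (a k) (a k) <= 0) ->
  (forall j k, (j < M.+4.+1)%N -> (k < M.+4.+1)%N ->
    F k.+1 - dotp (nu k) (a j - a k) + dotp (a j - a k) (a j - a k) <= F j.+1) ->
  (forall k, (k < M.+4.+1)%N -> th / 2 * dotp (p k.+1) (p k.+1) <= G k.+1) ->
  (forall k, (k < M.+4.+1)%N ->
    G k.+1 + dotp (p k.+1) (y k.+1) + th / 2 * dotp (p k.+1) (p k.+1) <= 0) ->
  (forall j k, (j < M.+4.+1)%N -> (k < M.+4.+1)%N ->
    G k.+1 - dotp (p k.+1) (y j.+1 - y k.+1)
      + th / 2 * dotp (p j.+1 - p k.+1) (p j.+1 - p k.+1) <= G j.+1) ->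
  - F N.+1 - G N.+1 - dotp (p N.+1) (a N + y N.+1)
    + 4^-1 * dotp (y N.+1 - y N) (y N.+1 - y N)
  <= 16^-1 * (1 + th) ^- (2 * M) * (dotp (p 0%N) (p 0%N) + dotp (y 0%N) (y 0%N)).
Proof.
move=> th0 th2 f0 fs fm g0 gs gm.
pose V k := dotp (p k) (p k) + dotp (y k) (y k).
have V1 : V 1%N <= V 0%N.
  apply: admm_step_nonexpansive.
    have := f0 0%N isT; have := fs 0%N isT.
    by have := dotp_ge0 (a 0%N); rewrite /nu /a; lra.
  have := g0 0%N isT; have := gs 0%N isT.
  by have := mulr_ge0 th0 (dotp_ge0 (p 1%N)); lra.
(* Adding the two inequalities of a pair cancels the function values and leaves strong monotonicity.
   Pairs of consecutive iterates start at index 1, as [p 0] and [y 0] need not be related. *)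
have VS k : (k.+1 < M.+4.+1)%N -> (1 + th) ^+ 2 * V k.+2 <= V k.+1.
  move=> kM; apply: admm_step_contraction => //.
  - by have := f0 _ kM; have := fs _ kM; rewrite /nu /a; lra.
  - by have := g0 _ kM; have := gs _ kM; lra.
  have := gm _ _ kM (ltnW kM); have := gm _ _ (ltnW kM) kM.
  by rewrite !dotpE (dotpC (p k.+1) (p k.+2)); lra.
have VM k : (k <= M)%N -> (1 + th) ^+ (2 * k) * V k.+1 <= V 0%N.
  elim: k => [|k IH kM]; first by rewrite muln0 expr0 mul1r.
  apply: le_trans (IH (ltnW kM)); rewrite mulnS addnC exprD -mulrA.
  rewrite ler_wpM2l ?exprn_ge0 ?addr_ge0 // VS //.
  by rewrite !ltnS ltnW // (leq_trans kM) // -addn3 leq_addr.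
have bound k : (k < 4)%N -> (k + M.+1 < M.+4.+1)%N by rewrite -(ltn_add2r M.+1 k 4).
have four : - F N.+1 - G N.+1 - dotp (p N.+1) (a N + y N.+1)
    + 4^-1 * dotp (y N.+1 - y N) (y N.+1 - y N) <= 16^-1 * V M.+1.
  apply: (@dual_gap_four_steps R n (fun k => p (k + M.+1)%N) (fun k => y (k + M.+1)%N)
    (fun k => F (k + M.+1)%N) (fun k => G (k + M.+1)%N)).
  - by move=> k /bound /f0.
  - by move=> k k3; apply: (fm (k.+1 + M.+1) (k + M.+1))%N; apply: bound; rewrite // ltnW.
  - move=> k /bound /g0; apply: le_trans; apply: mulr_ge0 (dotp_ge0 _); lra.
  - move=> k k4; have kM := bound _ k4.
    have := gm _ (k + M)%N kM; rewrite -addnS => /(_ (ltnW kM)).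
    have := mulr_ge0 th0 (dotp_ge0 (p (k + M.+1).+1 - p (k + M.+1)%N)).
    by rewrite addSn; lra.
  have := gm M M.+1 (ltnW (bound 0%N isT)) (bound 0%N isT).
  have := mulr_ge0 th0 (dotp_ge0 (p M.+1 - p M.+2)).
  by rewrite /=; lra.
apply: le_trans four _; rewrite -mulrA ler_wpM2l // mulrC ler_pdivlMr ?exprn_gt0 ?ltr_pwDl //.
by rewrite mulrC VM.
Qed.

(** * Optimality condition for a strongly convex, possibly infinite function *)

Section Minimizers.
Context {R : realType} {n r : nat}.
Implicit Types (f : 'cV[R]_n -> \bar R) (phi : 'cV[R]_n -> R) (A : 'M[R]_(r, n)).

Lemma argmin_fin_num f phi x : proper_fun f ->
  argmin (fun u => f u + (phi u)%:E)%E x -> f x \is a fin_num.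
Proof.
move=> [fNy [x0 fx0]] /(_ x0) /=; have := fNy x; have := fNy x0; move: fx0.
by case: (f x0) => [s||] //; case: (f x).
Qed.

(** Compare [x] with a point at fraction [s] of the way to [u]: the quadratic part of [phi] is of
    order [s ^+ 2], so to first order only [nu] and the full modulus [c / 2] remain. *)
Lemma strongly_convex_argmin f phi A (c C : R) (nu : 'cV[R]_r) x :
  Fc A c f -> argmin (fun u => f u + (phi u)%:E)%E x ->
  (forall u, phi u = phi x + dotp nu (A *m (u - x))
     + C * dotp (A *m (u - x)) (A *m (u - x))) ->
  forall u, f u \is a fin_num ->
    fine (f x) - dotp nu (A *m (u - x)) + c / 2 * dotp (A *m (u - x)) (A *m (u - x))
    <= fine (f u).
Proof.
move=> [_ fp fc] xmin phiE u fu; have fx := argmin_fin_num fp xmin.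
rewrite -subr_ge0; set d := A *m (u - x).
apply: (@ge0_of_first_order _ _ ((C + c / 2) * dotp d d)) => s /andP[s0 s1].
have s01 : 0 <= s <= 1 by rewrite ltW.
have := fc u x s s01; have := xmin (s *: u + (1 - s) *: x); rewrite /seminorm_mx !enorm_sqr.
have -> : phi (s *: u + (1 - s) *: x) = phi x + s * dotp nu d + s ^+ 2 * (C * dotp d d).
  rewrite phiE; have -> : s *: u + (1 - s) *: x - x = s *: (u - x).
    by apply/colP => i; rewrite !mxE; ring.
  by rewrite -scalemxAr -/d !dotpE; ring.
have -> : A *m (s *: u + (1 - s) *: x) = A *m x + s *: d.
  by rewrite /d scalemxAr -mulmxDr; congr (_ *m _); apply/colP => i; rewrite !mxE; ring.
have -> : A *m u = A *m x + d by rewrite /d mulmxBr addrC subrK.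
move: d => d; move: fu fx (fp.1 (s *: u + (1 - s) *: x)).
case: (f u) => [U| |] // _; case: (f x) => [X| |] // _.
case: (f _) => [W| |] // _; rewrite -?EFinD -?EFinB -?EFinM -?EFinD // !lee_fin /=.
rewrite !dotpE (dotpC d); lra.
Qed.

End Minimizers.

(** * Optimality condition for the smooth function, in terms of multipliers *)

Section SmoothMinimizers.
Context {R : realType} {m r : nat}.
Variables (L : R) (g : 'cV[R]_m -> \bar R) (B : 'M[R]_(r, m)).
Hypotheses (g_F0 : F0 g) (g_smooth : L_smooth L g).

Let g_fin z : g z \is a fin_num. Proof. by case: g_smooth. Qed.

Let g_diff z : differentiable (fine \o g) z. Proof. by case: g_smooth. Qed.

Let g_lip z1 z2 :
  enorm (gradient (fine \o g) z1 - gradient (fine \o g) z2) <= L * enorm (z1 - z2).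
Proof. by case: g_smooth. Qed.

Let g_convex u v (s : R) : 0 <= s <= 1 ->
  (fine \o g) (s *: u + (1 - s) *: v) <= s * (fine \o g) u + (1 - s) * (fine \o g) v.
Proof.
case: g_F0 => _ _ gc s01; have := gc u v s s01 => /=.
move: (g_fin u) (g_fin v) (g_fin (s *: u + (1 - s) *: v)).
by case: (g u) => // U _; case: (g v) => // V _; case: (g _).
Qed.

Lemma smooth_argmin phi (C : R) (nu : 'cV[R]_r) z :
  argmin (fun w => g w + (phi w)%:E)%E z ->
  (forall w, phi w = phi z + dotp nu (B *m (w - z))
     + C * dotp (B *m (w - z)) (B *m (w - z))) ->
  gradient (fine \o g) z = - (B^T *m nu).
Proof.
move=> zmin phiE.
apply: (gradient_of_minimizer g_diff g_lip (C := fun d => C * dotp (B *m d) (B *m d))).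
move=> d s _; have := zmin (z + s *: d) => /=.
rewrite [phi (z + _)]phiE [z + _ - z]addrC addKr -scalemxAr !dotpE (dotp_mulmx B nu).
move: (g_fin z) (g_fin (z + s *: d)); case: (g z) => // X _; case: (g _) => // Y _.
rewrite -!EFinD lee_fin /=.
lra.
Qed.

(** For an arbitrary point [w], which carries no multiplier, as in the Lagrangian bounded at the
    end. *)
Lemma multiplier_subgradient (mu : 'cV[R]_r) z w :
  gradient (fine \o g) z = - (B^T *m mu) ->
  fine (g z) - dotp mu (B *m (w - z)) <= fine (g w).
Proof.
move=> gz; have := gradient_inequality g_diff g_lip g_convex z w.
by rewrite gz dotpNl -dotp_mulmx.
Qed.

(* Cocoercivity of the gradient, pushed through B^T, is strong convexity in the multiplier. *)
Lemma multiplier_strong_convexity (sigma : R) (mu nu : 'cV[R]_r) z w : 0 < L ->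
  (forall v, sigma * dotp v v <= dotp v (B *m B^T *m v)) ->
  gradient (fine \o g) z = - (B^T *m mu) -> gradient (fine \o g) w = - (B^T *m nu) ->
  fine (g z) - dotp mu (B *m (w - z)) + sigma / (2 * L) * dotp (nu - mu) (nu - mu)
  <= fine (g w).
Proof.
move=> L0 sigmaP gz gw; have := cocoercive_inequality g_diff g_lip g_convex z w L0.
rewrite gz gw.
have -> : - (B^T *m nu) - - (B^T *m mu) = - (B^T *m (nu - mu)).
  by rewrite mulmxBr opprB opprK addrC.
rewrite !dotpNl dotpNr opprK -!dotp_mulmx mulmxA; apply: le_trans; rewrite lerD2l.
by rewrite mulrC [leRHS]mulrC mulrA ler_pM2r ?invr_gt0 ?mulr_gt0 // mulrC sigmaP.
Qed.

End SmoothMinimizers.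

(** On an eigenvector [v] the product of [sigma] and the squared norm of [v] is the squared norm of
    its image under [B^T], so [sigma] is nonnegative. *)
Lemma lambda_min_gram (R : realType) (r m : nat) (B : 'M[R]_(r, m))
    (sigma := lambda_min (B *m B^T)) : sigma != 0 ->
  0 < sigma /\ forall v, sigma * dotp v v <= dotp v (B *m B^T *m v).
Proof.
move=> sigma0; have symS : (B *m B^T)^T = B *m B^T by rewrite trmx_mul trmxK.
have [/eigenvalueP[v vS v0] sigmaP] := lambda_minP symS sigma0.
split=> //; rewrite lt_def sigma0 /=.
have vv : 0 < dotp v^T v^T by rewrite lt_def dotp_ge0 dotp_eq0 trmx_eq0 v0.
rewrite -(pmulr_lge0 _ vv) -dotpZr -linearZ /= -vS trmx_mul symS -mulmxA dotp_mulmx.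
exact: dotp_ge0.
Qed.

(** * Saddle point at the solution and bounds on the dual gap *)

Section DualGap.
Context {R : realType} {n m r : nat}.
Variables (f : 'cV[R]_n -> \bar R) (g : 'cV[R]_m -> \bar R).
Variables (A : 'M[R]_(r, n)) (B : 'M[R]_(r, m)) (b : 'cV[R]_r).
Variables (xs : 'cV[R]_n) (zs : 'cV[R]_m) (ls : 'cV[R]_r).
Hypotheses (f_gtNy : forall x, f x != -oo%E) (g_fin : forall z, g z \is a fin_num).
Hypothesis xzs_feasible : A *m xs + B *m zs = b.
Hypothesis strong_duality : dual f g A B b ls = (f xs + g zs)%E.

Lemma residualE x z : A *m x + B *m z - b = A *m (x - xs) + B *m (z - zs).
Proof. by rewrite -xzs_feasible !mulmxBr opprD addrACA. Qed.

Lemma saddle_point x z :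
  (f xs + g zs <= f x + g z + (dotp ls (A *m (x - xs) + B *m (z - zs)))%:E)%E.
Proof.
by rewrite -strong_duality -residualE; apply: ereal_inf_lbound; exists (x, z).
Qed.

Lemma saddle_argmin_x :
  argmin (fun u => f u + (dotp ls (A *m (u - xs)))%:E)%E xs.
Proof.
move=> u /=; have := saddle_point u zs; rewrite !subrr !mulmx0 addr0 dotp0r adde0.
by rewrite addeAC leeD2rE.
Qed.

Lemma saddle_argmin_z : f xs \is a fin_num ->
  argmin (fun w => g w + (dotp ls (B *m (w - zs)))%:E)%E zs.
Proof.
move=> fxs w /=; have := saddle_point xs w; rewrite !subrr !mulmx0 add0r dotp0r adde0.
by rewrite -addeA leeD2lE.
Qed.

(** A uniform lower bound on the Lagrangian at [l] bounds its infimum, the dual value; where [f] is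
    infinite the bound is trivial. *)
Lemma dual_gap_le (l : 'cV[R]_r) (K : R) : f xs \is a fin_num ->
  (forall x z, f x \is a fin_num ->
    fine (f xs) + fine (g zs) - K
    <= fine (f x) + fine (g z) + dotp l (A *m (x - xs) + B *m (z - zs))) ->
  (dual f g A B b ls - dual f g A B b l <= K%:E)%E.
Proof.
move=> fxs H; rewrite strong_duality.
have : ((fine (f xs) + fine (g zs) - K)%:E <= dual f g A B b l)%E.
  apply: le_ereal_inf_tmp => _ [[x z] _ <-] /=; rewrite residualE.
  have := H x z; move: (f_gtNy x) (g_fin z).
  case: (f x) => [X _||] //; case: (g z) => // Z _; last by rewrite addye // leey.
  by move=> /(_ isT); rewrite -!EFinD lee_fin.
move: fxs (g_fin zs); case: (f xs) => // X _; case: (g zs) => // Z _ /=.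
case: (dual _ _ _ _ _ _) => [D||] //=; last by rewrite leNye.
by rewrite -EFinB !lee_fin; lra.
Qed.
End DualGap.

(** * Scaling of the iterates and assembly of the bound *)

Theorem theorem9 (R : realType) (n m r : nat)
  (f : 'cV[R]_n -> \bar R) (g : 'cV[R]_m -> \bar R)
  (A : 'M[R]_(r, n)) (B : 'M[R]_(r, m)) (b : 'cV[R]_r)
  (c1 L t : R) (N : nat)
  (xs : 'cV[R]_n) (zs : 'cV[R]_m) (ls : 'cV[R]_r)
  (x : nat -> 'cV[R]_n) (z : nat -> 'cV[R]_m) (l : nat -> 'cV[R]_r)
  (A_neq0 : A != 0) (B_neq0 : B != 0)
  (c1_gt0 : 0 < c1) (f_Fc : Fc A c1 f)
  (g_F0 : F0 g) (g_smooth : L_smooth L g)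
  (opt : optimal_solution f g A B b xs zs)
  (multiplier : argmax (dual f g A B b) ls)
  (strong_duality : dual f g A B b ls = (f xs + g zs)%E)
  (N_ge5 : (5 <= N)%N)
  (B_full_row_rank : row_free B)
  (t_gt0 : 0 < t)
  (iterates : admm f g A B b t N x z l)
  (t_small : t < Num.min (c1 / 2) (L / (2 * lambda_min (B *m B^T)))) :
  let q := L / (L + t * lambda_min (B *m B^T)) in
  let V0 := enorm (l 0%N - ls) ^+ 2 + t ^+ 2 * seminorm_mx B (z 0%N - zs) ^+ 2 in
  let rho := V0 / (16 * t) * q ^- 10 in
  (dual f g A B b ls - dual f g A B b (l N) <= (rho * q ^+ (2 * N))%:E)%E.
Proof.
have [g_fin _ _] := g_smooth; have [_ f_proper _] := f_Fc; have [xzs _] := opt.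
move: t_small; rewrite lt_min; set sigma := lambda_min _ => /andP[t_lt_c1 t_lt_L].
(* If sigma = 0 then t_small reads t < L / 0 = 0. *)
have sigma_neq0 : sigma != 0.
  apply: contraTneq t_lt_L => ->; rewrite mulr0 invr0 mulr0 -leNgt; exact: ltW.
have [sigma_gt0 sigmaP] := lambda_min_gram sigma_neq0; rewrite -/sigma in sigma_gt0 sigmaP.
have L_gt0 : 0 < L.
  have := lt_trans t_gt0 t_lt_L; rewrite pmulr_lgt0 // invr_gt0; exact: mulr_gt0.
pose th := t * sigma / L.
have th_ge0 : 0 <= th by rewrite divr_ge0 ?mulr_ge0 // ltW.
have th_lt : th < 2^-1.
  rewrite ltr_pdivrMr // mulrC; move: t_lt_L; rewrite ltr_pdivlMr ?mulr_gt0 //; lra.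
have xs_min := saddle_argmin_x g_fin xzs strong_duality.
have fxs := argmin_fin_num f_proper xs_min.
have zs_min := saddle_argmin_z xzs strong_duality fxs.
pose a k := A *m (x k - xs); pose y k := B *m (z k - zs).
(* The multiplier updated with the old [z k]: the linear coefficient of the penalized x-subproblem
   at its minimizer. *)
pose nu k := l k + t *: (a k.+1 + y k).
have nuE k : (k < N)%N -> nu k = l k.+1 + t *: (y k - y k.+1).
  move=> kN; have [_ _ ->] := iterates _ kN; rewrite (residualE xzs) -/(a _) -/(y _).
  by apply/colP => i; rewrite !mxE; ring.
have x_min k : (k < N)%N -> argmin (fun u => f u + (dotp (l k) (A *m u)
    + t / 2 * enorm (A *m u + B *m z k - b) ^+ 2)%:E)%E (x k.+1).
  by move=> kN; have [] := iterates _ kN.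
have fx k : (k < N)%N -> f (x k.+1) \is a fin_num.
  by move=> /x_min; exact: argmin_fin_num.
(* The modulus [c1 / 2] is weakened to [t], which becomes 1 after division by [t]. *)
have f_opt u : f u \is a fin_num -> fine (f xs) - dotp ls (A *m (u - xs))
    + t * dotp (A *m (u - xs)) (A *m (u - xs)) <= fine (f u).
  move=> fu; apply: (le_trans _ (strongly_convex_argmin (C := 0) (nu := ls) f_Fc xs_min _ fu)).
    by rewrite lerD2l ler_wpM2r ?dotp_ge0 // ltW.
  by move=> v /=; rewrite subrr mulmx0 dotp0r add0r mul0r addr0.
have f_iter k u : (k < N)%N -> f u \is a fin_num ->
    fine (f (x k.+1)) - dotp (nu k) (A *m (u - x k.+1))
    + t * dotp (A *m (u - x k.+1)) (A *m (u - x k.+1)) <= fine (f u).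
  move=> kN fu.
  apply: (le_trans _
    (strongly_convex_argmin (C := t / 2) (nu := nu k) f_Fc (x_min _ kN) _ fu)).
    by rewrite lerD2l ler_wpM2r ?dotp_ge0 // ltW.
  move=> v; rewrite !enorm_sqr !(residualE xzs) -/(a _) -/(y _).
  have -> : A *m v = A *m x k.+1 + A *m (v - x k.+1) by rewrite -mulmxDr addrC subrK.
  have -> : A *m (v - xs) = a k.+1 + A *m (v - x k.+1).
    by rewrite /a -mulmxDr [in RHS]addrC subrKA.
  rewrite /nu; move: (A *m (v - _)) => d.
  by rewrite !dotpE (dotpC d) (dotpC d (y k)) (dotpC (y k) (a _)); field.
have g_opt : gradient (fine \o g) zs = - (B^T *m ls).
  apply: (smooth_argmin (C := 0) g_smooth zs_min) => w.
  by rewrite subrr mulmx0 dotp0r add0r mul0r addr0.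
have g_iter k : (k < N)%N -> gradient (fine \o g) (z k.+1) = - (B^T *m l k.+1).
  move=> kN; have [_ z_min ->] := iterates _ kN.
  apply: (smooth_argmin (C := t / 2) g_smooth z_min) => w.
  rewrite !enorm_sqr !(residualE xzs) -/(a _) -/(y _).
  have -> : B *m w = B *m z k.+1 + B *m (w - z k.+1) by rewrite -mulmxDr addrC subrK.
  have -> : B *m (w - zs) = y k.+1 + B *m (w - z k.+1).
    by rewrite /y -mulmxDr [in RHS]addrC subrKA.
  move: (B *m (w - _)) => d.
  by rewrite !dotpE (dotpC d) (dotpC d (y _)) (dotpC (y _) (a _)); field.
have g_mult := multiplier_strong_convexity g_F0 g_smooth L_gt0 sigmaP.
have [M N_M] : exists M, N = M.+4.+1.
  by exists (N - 5)%N; rewrite -[LHS](subnK N_ge5) !addnS addn0.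
subst N; set N := M.+4.+1.
have t_neq0 : t != 0 by rewrite gt_eqF.
pose p k := t^-1 *: (l k - ls).
(* Subtracting the value at the solution and adding the linear term of [ls] turns the saddle point
   into a minimizer with value 0. *)
pose F k := t^-1 * (fine (f (x k)) - fine (f xs) + dotp ls (a k)).
pose G k := t^-1 * (fine (g (z k)) - fine (g zs) + dotp ls (y k)).
have lE k : l k = ls + t *: p k by rewrite scalerA divff // scale1r addrC subrK.
have plE k : l k - ls = t *: p k by rewrite scalerA divff // scale1r.
(* The multiplier update in scaled form. The sequence [a] of [dual_gap_decay] is thus shifted by one
   against the one here. *)
have aE k : (k < N)%N -> p k.+1 - p k - y k.+1 = a k.+1.
  move=> kN; rewrite /p; have [_ _ ->] := iterates _ kN.
  by rewrite (residualE xzs) -/(a _) -/(y _); apply/colP => i; rewrite !mxE; field.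
have nuE' k : (k < N)%N -> nu k = ls + t *: (p k.+1 + y k - y k.+1).
  by move=> /nuE ->; rewrite lE -addrA -scalerDr addrA.
have AE j k : A *m (x j - x k) = a j - a k.
  by rewrite /a -mulmxBr opprB addrA subrK.
have BE j k : B *m (z j - z k) = y j - y k.
  by rewrite /y -mulmxBr opprB addrA subrK.
have AsE k : A *m (xs - x k) = - a k by rewrite /a -mulmxN opprB.
have BsE k : B *m (zs - z k) = - y k by rewrite /y -mulmxN opprB.
have tF k : fine (f (x k)) - fine (f xs) + dotp ls (a k) = t * F k by rewrite mulVKf.
have tG k : fine (g (z k)) - fine (g zs) + dotp ls (y k) = t * G k by rewrite mulVKf.
have thE v : sigma / (2 * L) * dotp (t *: v) (t *: v) = t * (th / 2 * dotp v v).
  by rewrite !dotpE /th; field; rewrite gt_eqF.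
have plBE j k : l j - l k = t *: (p j - p k) by rewrite !lE scalerBr opprD addrACA subrr add0r.
have decay := @dual_gap_decay R r M th p y F G th_ge0 th_lt.
have {decay} : - F N - G N - dotp (p N) (a N + y N)
    + 4^-1 * dotp (y N - y M.+4) (y N - y M.+4)
    <= 16^-1 * (1 + th) ^- (2 * M) * (dotp (p 0%N) (p 0%N) + dotp (y 0%N) (y 0%N)).
  rewrite -(aE M.+4) //; apply: decay => [k|k|j k|k|k|j k].
  - move=> kN; rewrite aE // -(ler_pM2l t_gt0) -tF.
    by have := f_opt _ (fx _ kN); rewrite -/(a _); lra.
  - move=> kN; rewrite aE // -(ler_pM2l t_gt0) !mulrDr -tF mulr0.
    have := f_iter _ _ kN fxs; rewrite AsE nuE' // !dotpE; lra.
  - move=> jN kN; rewrite !aE // -(ler_pM2l t_gt0) !mulrDr -!tF.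
    have := f_iter _ _ kN (fx _ jN); rewrite AE nuE' //.
    move: (p k.+1 + y k - y k.+1) => v.
    rewrite dotpDl dotpZl (dotpDr ls) dotpNr; lra.
  - move=> kN; rewrite -(ler_pM2l t_gt0) -tG -thE.
    have := g_mult _ _ _ _ g_opt (g_iter _ kN).
    by rewrite -/(y _) plE; lra.
  - move=> kN; rewrite -(ler_pM2l t_gt0) !mulrDr mulr0 -tG -thE.
    have := g_mult _ _ _ _ (g_iter _ kN) g_opt.
    rewrite BsE -(opprB (l k.+1)) plE [l k.+1]lE !dotpE; lra.
  - move=> jN kN; rewrite -(ler_pM2l t_gt0) !mulrDr -!tG -thE.
    have := g_mult _ _ _ _ (g_iter _ kN) (g_iter _ jN).
    rewrite BE plBE [l k.+1]lE (dotpDl ls) (dotpZl t (p _)).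
    set X := dotp (t *: _) _; move: X => X.
    rewrite (dotpDr ls) dotpNr; lra.
move=> decay; lazy zeta; set q := L / _.
apply: (dual_gap_le f_proper.1 g_fin xzs strong_duality fxs) => u w fu.
have N1 : (M.+4 < N)%N by [].
(* Both functions are bounded below from the last iterate at an arbitrary point, hence so is the
   Lagrangian at [l N]. *)
have := f_iter _ _ N1 fu; have := multiplier_subgradient g_F0 g_smooth w (g_iter _ N1).
have -> : A *m (u - xs) = a N + A *m (u - x N) by rewrite /a -mulmxDr [in RHS]addrC subrKA.
have -> : B *m (w - zs) = y N + B *m (w - z N) by rewrite /y -mulmxDr [in RHS]addrC subrKA.
rewrite nuE //.
have dE : dotp (y N - y M.+4) (y N - y M.+4) = dotp (y M.+4 - y N) (y M.+4 - y N).
  by rewrite -opprB dotpNl dotpNr opprK.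
move: decay; rewrite {}dE; move: (y M.+4 - y N) (A *m (u - x N)) (B *m (w - z N)).
move=> d e e' decay.
(* Young's inequality: the cross term, due to the last [nu] differing from [l N] by [t *: d], is
   absorbed by strong convexity of [f]. *)
have sq : t * dotp d e <= t * dotp e e + t / 4 * dotp d d.
  rewrite -subr_ge0.
  have -> : t * dotp e e + t / 4 * dotp d d - t * dotp d e
    = t * dotp (e - 2^-1 *: d) (e - 2^-1 *: d).
    by rewrite !dotpE (dotpC e d); field.
  by rewrite mulr_ge0 ?dotp_ge0 // ltW.
have -> : (enorm (l 0%N - ls) ^+ 2 + t ^+ 2 * seminorm_mx B (z 0%N - zs) ^+ 2)
    / (16 * t) * q ^- 10 * q ^+ (2 * N) = t * (16^-1 * (1 + th) ^- (2 * M)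
    * (dotp (p 0%N) (p 0%N) + dotp (y 0%N) (y 0%N))).
  have q_neq0 : q != 0.
    by rewrite /q mulf_neq0 ?invr_neq0 ?gt_eqF // addr_gt0 // mulr_gt0.
  have -> : (1 + th) ^- (2 * M) = q ^+ (2 * M).
    rewrite -exprVn; congr (_ ^+ _); rewrite /q /th; field.
    by rewrite !gt_eqF // addr_gt0 // mulr_gt0.
  (* The five steps without contraction account for the factor [q ^- 10]. *)
  have -> : (2 * N = 2 * M + 10)%N by rewrite /N !mulnS !addnS addn0.
  rewrite /seminorm_mx !enorm_sqr plE -/(y 0%N) !dotpE exprD.
  by move: (q ^+ (2 * M)) => qM; field; rewrite t_neq0.
have := ler_wpM2l (ltW t_gt0) decay; rewrite !mulrDr !mulrN -tF -tG.
have -> : t * dotp (p N) (a N + y N) = dotp (l N) (a N + y N) - dotp ls (a N + y N).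
  by rewrite -dotpZl -plE dotpDl dotpNl.
rewrite (dotpDl (l N)) dotpZl !(dotpDr (l N)) !(dotpDr ls); lra.
Qed.
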